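(* Let $\alpha\in[0,\tfrac12]$ and let $\mathbf{T}(\alpha)\in\mathbb{R}^{n\times n}$ be the $\alpha$-tridiagonal matrix, i.e. the symmetric tridiagonal matrix with all diagonal entries equal to $1$, all entries on the first sub- and superdiagonal equal to $\alpha$, and all other entries $0$. Let $\mathbf{M}=\mathbf{G}=\mathbf{T}(\alpha)$, let $\hat S$ be the $2$-list sampling (the common distribution of each set in the serial or parallel $2$-list sampling), and let $$\theta=\lambda_{\max}\left(\mathbf{G}^{1/2}\,\mathbb{E}\left[(\mathbf{M}_{\hat S})^{-1}\right]\mathbf{G}^{1/2}\right).$$ Then $$\theta\le\frac{2}{(1-\alpha)n}.$$
   Context: The $2$-list sampling (for $n\ge2$) picks uniformly at random a subset of $[n]=\{1,\dots,n\}$ of cardinality $2$ consisting of successive elements modulo $n$, i.e. one of $\{1,2\},\{2,3\},\dots,\{n-1,n\},\{n,1\}$. For nonempty $S\subseteq[n]$, $\mathbf{I}_{:S}$ is the $n\times|S|$ matrix formed by the columns of the identity matrix indexed by $S$, $\mathbf{M}_{SS}=\mathbf{I}_{:S}^\top\mathbf{M}\mathbf{I}_{:S}$, and $(\mathbf{M}_S)^{-1}$ denotes the $n\times n$ matrix $\mathbf{I}_{:S}(\mathbf{M}_{SS})^{-1}\mathbf{I}_{:S}^\top$. The choice $\mathbf{M}=\mathbf{G}=\mathbf{T}(\alpha)$ corresponds to the quadratic objective $f(x)=\frac12x^\top\mathbf{T}(\alpha)x$. *)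

(* Defs.v *)
From mathcomp Require Import all_boot all_order all_algebra.
From mathcomp Require Import boolp classical_sets reals.

Set Implicit Arguments.
Unset Strict Implicit.
Unset Printing Implicit Defensive.

Import Order.TTheory GRing.Theory Num.Theory.
Local Open Scope ring_scope.

Definition tridiag_mx {R : realType} (n : nat) (alpha : R) : 'M[R]_n :=
  \matrix_(i < n, j < n)
    if i == j then 1
    else if (i.+1 == j :> nat) || (j.+1 == i :> nat) then alpha
    else 0.

(* I_{:S}: the columns of the identity indexed by S, in increasing order. *)
Definition col_id {R : realType} (n : nat) (S : {set 'I_n}) : 'M[R]_(n, #|S|) :=
  colsub (fun k : 'I_#|S| => enum_val k) 1%:M.

(* M_SS, defined as the product I_{:S}^T M I_{:S}. *)
Definition principal_submx {R : realType} (n : nat) (M : 'M[R]_n)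
    (S : {set 'I_n}) : 'M[R]_#|S| :=
  (col_id S)^T *m M *m col_id S.

(* (M_S)^{-1} = I_{:S} (M_SS)^{-1} I_{:S}^T. Since [invmx] is the identity map
   on singular matrices, this is meaningful when M_SS is invertible, e.g. when
   M is positive definite. *)
Definition sub_invmx {R : realType} (n : nat) (M : 'M[R]_n)
    (S : {set 'I_n}) : 'M[R]_n :=
  col_id S *m invmx (principal_submx M S) *m (col_id S)^T.

(* The sets {i, i+1 mod n}; [ordS] is the cyclic successor on 'I_n. For n = 2
   the two pairs {1,2} and {2,1} are the same set. *)
Definition two_lists (n : nat) : {set {set 'I_n}} :=
  [set [set i; ordS i] | i : 'I_n]%SET.

Definition two_list_sampling {R : realType} (n : nat) (S : {set 'I_n}) : R :=
  if S \in two_lists n then (#|two_lists n|%:R)^-1 else 0.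

(* Expectation of the matrix X(S) for a random subset S of {0, ..., n-1} with
   probability mass function p. *)
Definition expectation_mx {R : realType} (n : nat) (p : {set 'I_n} -> R)
    (X : {set 'I_n} -> 'M[R]_n) : 'M[R]_n :=
  \sum_(S : {set 'I_n}) p S *: X S.

Definition psd_mx {R : realType} (n : nat) (A : 'M[R]_n) : Prop :=
  A^T = A /\ forall x : 'cV[R]_n, 0 <= (x^T *m A *m x) ord0 ord0.

(* The positive semidefinite square root: for positive semidefinite A there is
   exactly one B as below. The value 0 is only a default for other A. *)
Definition sqrt_mx {R : realType} (n : nat) (A : 'M[R]_n) : 'M[R]_n :=
  xget 0 [set B : 'M[R]_n | psd_mx B /\ B *m B = A]%classic.

(* The largest real eigenvalue. For n > 0 and A symmetric the set of real
   eigenvalues is finite and nonempty, so that its supremum is its maximum. *)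
Definition lambda_max {R : realType} (n : nat) (A : 'M[R]_n) : R :=
  sup [set a : R | eigenvalue A a]%classic.

Definition theta {R : realType} (n : nat) (p : {set 'I_n} -> R)
    (M G : 'M[R]_n) : R :=
  lambda_max (sqrt_mx G *m expectation_mx p (sub_invmx M) *m sqrt_mx G).

(* Main.v *)
Require Import Defs.
From mathcomp Require Import all_boot all_order all_algebra.
From mathcomp Require Import boolp classical_sets reals.
From mathcomp Require Import ring lra zify.
Import Order.TTheory GRing.Theory Num.Theory.
Local Open Scope ring_scope.

(** Write T for the tridiagonal matrix, P for the expected matrix, and
    q_A(v) = v A v^T. If B = T^(1/2), every eigenvalue of B P B is at most c as
    soon as q_P(v B) <= c |v|^2 for all v ([lambda_max_le]), so the task is to
    bound q_P from above by the form of a polynomial in T, which commutes with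
    B.

    Let n >= 3. For a pair S = {i, j} with M_ij = a, the matrix (M_S)^-1 has the
    quadratic form (y_i^2 + y_j^2 - 2 a y_i y_j) / (1 - a^2), and a is alpha for
    every pair except the wrap-around pair {n, 1}, where it is 0. Enlarging
    the form of that last pair by the factor 1 / (1 - alpha^2), which is at
    least 1, makes the denominators equal; each index lies in two pairs, so the
    sum over the pairs is
      n (1 - alpha^2) q_P(y) <= 2 |y|^2 - (q_T(y) - |y|^2)
                              = 3 |y|^2 - q_T(y)   ([qform_expectation_le]).
    At y = v B the right-hand side is 3 q_T(v) - q_(T^2)(v). Since
    |v T - v|^2 >= 0, it is at most q_T(v) + |v|^2, and since no eigenvalue
    of T exceeds 1 + 2 alpha ([qform_tridiag_le]), this is at most
    2 (1 + alpha) |v|^2. Dividing by n (1 - alpha) (1 + alpha) gives the bound.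

    For n = 2 there is a single pair and P = T^-1 satisfies
    (1 - alpha^2) q_P(y) = 2 |y|^2 - q_T(y), which at y = v B and again
    by |v T - v|^2 >= 0 gives
    q_P(v B) <= |v|^2 / (1 - alpha^2) <= |v|^2 / (1 - alpha). *)

(** * Quadratic forms and the largest eigenvalue *)

Definition qform {R : realType} {n : nat} (A : 'M[R]_n) (v : 'rV[R]_n) : R :=
  (v *m A *m v^T) 0 0.

Lemma qformZ {R : realType} {n : nat} (c : R) (A : 'M[R]_n) v :
  qform (c *: A) v = c * qform A v.
Proof. by rewrite /qform -scalemxAr -scalemxAl mxE. Qed.

Lemma qformD {R : realType} {n : nat} (A B : 'M[R]_n) v :
  qform (A + B) v = qform A v + qform B v.
Proof. by rewrite /qform mulmxDr mulmxDl mxE. Qed.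

Lemma qform_sum {R : realType} {n : nat} (I : finType) (A : I -> 'M[R]_n) v :
  qform (\sum_i A i) v = \sum_i qform (A i) v.
Proof. by rewrite /qform mulmx_sumr mulmx_suml summxE. Qed.

Lemma qform_delta {R : realType} {n : nat} (i j : 'I_n) (v : 'rV[R]_n) :
  qform (delta_mx i j) v = v 0 i * v 0 j.
Proof.
rewrite /qform mxE (bigD1 j) //= !mxE (bigD1 i) //= mxE !eqxx mulr1.
rewrite !big1 ?addr0 // => k nk; rewrite !mxE ?(negPf nk) ?mulr0 //.
rewrite big1 ?mul0r // => l _; by rewrite mxE (negPf nk) andbF mulr0.
Qed.

Lemma qform1 {R : realType} {n : nat} (v : 'rV[R]_n) :
  qform 1%:M v = \sum_i v 0 i ^+ 2.
Proof.
rewrite /qform mulmx1 mxE; apply: eq_bigr => i _; by rewrite mxE expr2.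
Qed.

Lemma qform1_ge0 {R : realType} {n : nat} (v : 'rV[R]_n) : 0 <= qform 1%:M v.
Proof. by rewrite qform1 sumr_ge0 // => i _; rewrite sqr_ge0. Qed.

Lemma qform1_gt0 {R : realType} {n : nat} (v : 'rV[R]_n) :
  v != 0 -> 0 < qform 1%:M v.
Proof.
move=> v_neq0; rewrite lt_neqAle qform1_ge0 andbT eq_sym.
apply: contra v_neq0; rewrite qform1 psumr_eq0; last by move=> *; rewrite sqr_ge0.
move=> /allP v0; apply/eqP/rowP => i; rewrite mxE; apply/eqP.
by have := v0 i (mem_index_enum i); rewrite sqrf_eq0.
Qed.

Lemma qform_congr {R : realType} {n : nat} (A B : 'M[R]_n) v :
  qform A (v *m B) = qform (B *m A *m B^T) v.
Proof. by rewrite /qform trmx_mul !mulmxA. Qed.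

(** This is the positivity of |v A - v|^2, expanded. *)
Lemma qform_sqr_ge {R : realType} {n : nat} (A : 'M[R]_n) v :
  A^T = A -> 2%:R * qform A v - qform 1%:M v <= qform (A *m A) v.
Proof.
move=> symA; have := qform1_ge0 (v *m (A - 1%:M)).
rewrite qform_congr linearB /= symA trmx1 mulmx1 mulmxBr mulmx1 mulmxBl mul1mx.
rewrite /qform !mulmxBr !mulmxBl !mxE; lra.
Qed.

(** At an eigenvector v the quotient of qform A v by |v|^2 is the eigenvalue
    itself. The sign of c matters when A has no real eigenvalue, because the
    supremum of the empty set is 0. *)
Lemma lambda_max_le {R : realType} {n : nat} (A : 'M[R]_n) (c : R) :
  0 <= c -> (forall v, qform A v <= c * qform 1%:M v) -> lambda_max A <= c.
Proof.
move=> c_ge0 Ac; rewrite /lambda_max.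
have ub a : eigenvalue A a -> a <= c.
  move=> /eigenvalueP[v vA v_neq0]; have := Ac v.
  have -> : qform A v = a * qform 1%:M v.
    by rewrite /qform vA mulmx1 -scalemxAl mxE.
  by rewrite ler_pM2r // qform1_gt0.
have [[a Aa]|noA] := pselect (exists a, eigenvalue A a).
  by apply: ge_sup; [exists a | move=> b; apply: ub].
by rewrite sup_out // => -[[a Aa] _]; apply: noA; exists a.
Qed.

(** The defining properties of the square root. The default value 0 is kept as an
    alternative, because the form to be bounded vanishes there. *)
Lemma sqrt_mx_spec {R : realType} {n : nat} (A : 'M[R]_n) :
  sqrt_mx A = 0 \/ psd_mx (sqrt_mx A) /\ sqrt_mx A *m sqrt_mx A = A.
Proof. by rewrite /sqrt_mx; case: xgetP => [B _ /= ?|]; [right|left]. Qed.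

(** * Inverses of principal submatrices *)

Lemma col_id_gram {R : realType} {n : nat} (S : {set 'I_n}) :
  (Defs.col_id S)^T *m Defs.col_id S = 1%:M :> 'M[R]_#|S|.
Proof.
apply/matrixP => k l; rewrite !mxE (bigD1 (enum_val k)) //= !mxE eqxx mul1r.
rewrite (inj_eq enum_val_inj) big1 ?addr0 // => i ni.
by rewrite !mxE (negPf ni) mul0r.
Qed.

Lemma col_id_proj {R : realType} {n : nat} (S : {set 'I_n}) :
  Defs.col_id S *m (Defs.col_id S)^T = \sum_(i in S) delta_mx i i :> 'M[R]_n.
Proof.
apply/matrixP => k l; rewrite mxE summxE [RHS]big_enum_val /=.
apply: eq_bigr => m _; rewrite !mxE -natrM mulnb.
by rewrite ![_ == enum_val m]eq_sym.
Qed.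

(** (M_S)^-1 is the only matrix supported on S x S that inverts M there; E is
    the coordinate projection I_{:S} I_{:S}^T. With this criterion the inverse
    can be checked among n x n matrices, where the entries are indexed by
    'I_n and no enumeration of S is involved. *)
Lemma sub_invmx_unique {R : realType} {n : nat} (M N : 'M[R]_n) (S : {set 'I_n})
    (E := \sum_(i in S) delta_mx i i : 'M[R]_n) :
  E *m M *m E *m N = E -> E *m N *m E = N -> sub_invmx M S = N.
Proof.
rewrite /E -col_id_proj /sub_invmx /principal_submx; set C := Defs.col_id S.
set K := C^T *m M *m C => invE EN.
have CC : C^T *m C = 1%:M by exact: col_id_gram.
have KN : K *m (C^T *m N *m C) = 1%:M.
  move/(congr1 (fun X => C^T *m X *m C)): invE => /=.
  by rewrite /K !mulmxA CC mul1mx CC.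
have [unitK _] := mulmx1_unit KN.
by rewrite -[invmx K]mulmx1 -KN mulKmx // -[RHS]EN !mulmxA.
Qed.

Lemma delta_sandwich {R : realType} {n : nat} (M : 'M[R]_n) (i j : 'I_n) :
  delta_mx i i *m M *m delta_mx j j = M i j *: delta_mx i j.
Proof.
apply/matrixP => k l; rewrite !mxE (bigD1 j) //= big1 ?addr0 => [|m nm].
  rewrite !mxE (bigD1 i) //= big1 ?addr0 => [|m nm].
    by rewrite !mxE !eqxx andbT /=; case: (k == i); case: (l == j); rewrite /=; ring.
  by rewrite !mxE (negPf nm) andbF mul0r.
by rewrite !mxE (negPf nm) mulr0.
Qed.

(** The inverse of the 2 x 2 matrix with rows (1, a) and (a, 1). *)
Lemma sub_invmx_pair {R : realType} {n : nat} (M : 'M[R]_n) (i j : 'I_n)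
    (a : R) :
  i != j -> M i i = 1 -> M j j = 1 -> M i j = a -> M j i = a ->
  1 - a ^+ 2 != 0 ->
  sub_invmx M [set i; j] =
    (1 - a ^+ 2)^-1 *:
      (delta_mx i i + delta_mx j j - a *: (delta_mx i j + delta_mx j i)).
Proof.
move=> ij Mii Mjj Mij Mji a_ok; have ji : j != i by rewrite eq_sym.
have mulE := (mulmxDl, mulmxDr, mulmxBl, mulmxBr, mulmxN, mulNmx, =^~ scalemxAr,
  =^~ scalemxAl, mul_delta_mx_cond, eqxx, negPf ij, negPf ji).
apply: sub_invmx_unique; rewrite big_setU1 ?inE //= big_set1.
  (* The projection turns M into its four entries on {i, j} x {i, j}; the
     rest is a product of combinations of matrix units. *)
  rewrite !mulmxDl !mulmxDr !mulmxDl !delta_sandwich Mii Mjj Mij Mji !scale1r.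
  rewrite !(mulE, mulr0n, mulr1n, mul0mx).
  apply/matrixP => k l; rewrite !mxE.
  set x := (_ && _)%:R; set y := (_ && _)%:R; set z := (_ && _)%:R; set t := (_ && _)%:R.
  by field.
rewrite !(mulE, mulr0n, mulr1n, mul0mx).
apply/matrixP => k l; rewrite !mxE; ring.
Qed.

Lemma qform_sub_invmx_pair {R : realType} {n : nat} (M : 'M[R]_n) (i j : 'I_n)
    (a : R) v :
  i != j -> M i i = 1 -> M j j = 1 -> M i j = a -> M j i = a ->
  1 - a ^+ 2 != 0 ->
  qform (sub_invmx M [set i; j]) v =
    (v 0 i ^+ 2 + v 0 j ^+ 2 - 2%:R * a * (v 0 i * v 0 j)) / (1 - a ^+ 2).
Proof.
move=> ij Mii Mjj Mij Mji a_ok; rewrite (sub_invmx_pair _ _ _ a) // -scaleN1r.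
rewrite !(qformZ, qformD, qform_delta); field.
exact: a_ok.
Qed.

(** * The tridiagonal matrix as a sum over cyclic links *)

(** The sampled pairs are the links i -- ordS i of a cycle, the nonzero
    off-diagonal entries of the tridiagonal matrix the links of a path.
    Weight 0 on the wrap-around link puts both on the same index set. *)
Definition link_weight {R : realType} (n : nat) (alpha : R) (i : 'I_n) : R :=
  if (i.+1 < n)%N then alpha else 0.

Lemma ordS_neq (n : nat) (i : 'I_n) : (1 < n)%N -> i != ordS i.
Proof.
move=> n_gt1; rewrite -val_eqE /=; have [lt|] := ltnP i.+1 n.
  by rewrite modn_small //; lia.
move=> le; have -> : i.+1 = n by have := ltn_ord i; lia.
by rewrite modnn; have := ltn_ord i; lia.
Qed.

Lemma tridiag_mxE {R : realType} (n : nat) (alpha : R) : (1 < n)%N ->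
  tridiag_mx n alpha =
    1%:M + \sum_i link_weight n alpha i *: (delta_mx i (ordS i) + delta_mx (ordS i) i).
Proof.
move=> n_gt1; apply/matrixP => k l; rewrite !mxE summxE.
transitivity ((k == l)%:R + (link_weight n alpha k * (l == ordS k)%:R +
    link_weight n alpha l * (k == ordS l)%:R)); last first.
  congr (_ + _).
  under eq_bigr => i _ do rewrite !mxE mulrDr.
  rewrite big_split /=; congr (_ + _).
    rewrite (bigD1 k) //= eqxx /= big1 ?addr0 // => i ni.
    by rewrite eq_sym (negPf ni) mulr0.
  rewrite (bigD1 l) //= eqxx andbT big1 ?addr0 // => i ni.
  by rewrite [l == i]eq_sym (negPf ni) andbF mulr0.
have linkE (a b : 'I_n) :
    link_weight n alpha a * (b == ordS a)%:R = alpha * (a.+1 == b :> nat)%:R.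
  rewrite /link_weight -(val_eqE b) /=; case: ltnP => [lt|le].
    by rewrite modn_small // eq_sym.
  by rewrite (_ : (a.+1 == b) = false) ?mul0r ?mulr0 //; have := ltn_ord b; lia.
rewrite !linkE -(val_eqE k) /=; case: eqVneq => [->|_].
  by rewrite (_ : (_.+1 == _) = false) ?mulr0 ?addr0 //; lia.
have [<-|_] /= := eqVneq k.+1 l.
  by rewrite (_ : (_.+1 == _) = false) ?mulr0 ?mulr1 ?addr0 ?add0r //; lia.
by case: (_ == _); rewrite ?mulr0 ?mulr1 ?addr0 ?add0r.
Qed.

Lemma tridiag_mx_sym {R : realType} (n : nat) (alpha : R) :
  (tridiag_mx n alpha)^T = tridiag_mx n alpha.
Proof. by apply/matrixP => i j; rewrite !mxE eq_sym orbC. Qed.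

Lemma qform_tridiag {R : realType} (n : nat) (alpha : R) v : (1 < n)%N ->
  qform (tridiag_mx n alpha) v =
    qform 1%:M v + 2%:R * \sum_i link_weight n alpha i * (v 0 i * v 0 (ordS i)).
Proof.
move=> n_gt1; rewrite tridiag_mxE // qformD qform_sum mulr_sumr; congr (_ + _).
by apply: eq_bigr => i _; rewrite qformZ qformD !qform_delta; ring.
Qed.

(** Every index lies on exactly two links of the cycle. *)
Lemma sum_sqr_ordS {R : realType} {n : nat} (v : 'rV[R]_n) :
  \sum_i (v 0 i ^+ 2 + v 0 (ordS i) ^+ 2) = 2%:R * qform 1%:M v.
Proof.
rewrite big_split /= qform1 mulr2n mulrDl !mul1r; congr (_ + _).
by rewrite [RHS](reindex _ (onW_bij _ (ordS_bij n))).
Qed.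

(** Apply 2 x y <= x^2 + y^2 on each link; the ends of all the links cover every
    index twice. *)
Lemma qform_tridiag_le {R : realType} (n : nat) (alpha : R) v : (1 < n)%N ->
  0 <= alpha -> qform (tridiag_mx n alpha) v <= (1 + 2%:R * alpha) * qform 1%:M v.
Proof.
move=> n_gt1 alpha_ge0; rewrite qform_tridiag // [leRHS]mulrDl mul1r lerD2l.
rewrite (mulrC 2%:R alpha) -mulrA -sum_sqr_ordS !mulr_sumr; apply: ler_sum => i _.
set x := v 0 i; set y := v 0 (ordS i); rewrite /link_weight; case: ifP => _.
  have := mulr_ge0 alpha_ge0 (sqr_ge0 (x - y)); lra.
by rewrite mul0r mulr0 mulr_ge0 // addr_ge0 ?sqr_ge0.
Qed.

(** * The expectation over two-lists *)

(** Two distinct links with the same ends would force i + 2 = i modulo n. This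
    is where n = 2 differs. *)
Lemma two_list_inj (n : nat) : (2 < n)%N ->
  injective (fun i : 'I_n => [set i; ordS i]).
Proof.
move=> n_gt2 i j eqS; apply/eqP; apply: contraT => ij.
have : i \in [set j; ordS j] by rewrite -eqS !inE eqxx.
have : j \in [set i; ordS i] by rewrite eqS !inE eqxx.
rewrite !inE eq_sym (negPf ij) /= => /eqP ji /eqP; rewrite ji => /(congr1 val) /=.
rewrite -[(_ %% n).+1]addn1 modnDml addn1 -{1}(modn_small (ltn_ord i)) => /esym/eqP.
rewrite eqn_mod_dvd; last by lia.
rewrite (_ : _ - _ = 2)%N; last by lia.
by move/dvdn_leq => /(_ isT); lia.
Qed.

Lemma expectation_two_list {R : realType} (n : nat) (X : {set 'I_n} -> 'M[R]_n) :
  expectation_mx (two_list_sampling (n := n)) X =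
    #|two_lists n|%:R^-1 *: \sum_(S in two_lists n) X S.
Proof.
rewrite /expectation_mx scaler_sumr [RHS]big_mkcond /=; apply: eq_bigr => S _.
by rewrite /two_list_sampling; case: ifP; rewrite ?scale0r.
Qed.

(** For n = 2 the wrap-around link joins neighbours of the path, so that the
    entry would be alpha instead of 0. *)
Lemma tridiag_ordS {R : realType} (n : nat) (alpha : R) (i : 'I_n) : (2 < n)%N ->
  tridiag_mx n alpha i (ordS i) = link_weight n alpha i.
Proof.
move=> n_gt2; rewrite mxE (negPf (ordS_neq _ _ _)) ?(ltnW n_gt2) // /link_weight /=.
have lt_in := ltn_ord i; case: (ltnP i.+1 n) => [lt|le].
  by rewrite modn_small // eqxx.
have -> : i.+1 = n by lia.
by rewrite modnn; case: eqP; case: eqP => //=; lia.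
Qed.

(** In terms of matrices, (1 - alpha^2) n P <= 3 I - T: the difference comes
    from the wrap-around pair alone. *)
Lemma qform_expectation_le {R : realType} (n : nat) (alpha : R) v : (2 < n)%N ->
  0 <= alpha -> alpha < 1 ->
  n%:R * (1 - alpha ^+ 2) *
    qform (expectation_mx (two_list_sampling (n := n))
             (sub_invmx (tridiag_mx n alpha))) v
    <= 3%:R * qform 1%:M v - qform (tridiag_mx n alpha) v.
Proof.
move=> n_gt2 alpha_ge0 alpha_lt1; have n_gt1 := ltnW n_gt2.
have alpha2_lt1 : alpha ^+ 2 < 1 by nra.
have injS := two_list_inj _ n_gt2.
rewrite expectation_two_list card_imset // card_ord (big_imset _ (in2W injS)) /=.
rewrite qformZ qform_sum.
have n_neq0 : n%:R != 0 :> R by rewrite pnatr_eq0; lia.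
rewrite mulrACA mulfV // mul1r mulr_sumr qform_tridiag // opprD addrA.
(* One copy of |v|^2 is absorbed by the diagonal of T; the other two are
   distributed over the links, and the inequality then holds link by link. *)
rewrite -[X in _ - X - _]mul1r -mulrBl (_ : 3%:R - 1 = 2%:R); last by ring.
rewrite -sum_sqr_ordS mulr_sumr -sumrB; apply: ler_sum => i _.
have link2_lt1 : link_weight n alpha i ^+ 2 < 1.
  by rewrite /link_weight; case: ifP; rewrite // expr0n.
rewrite (qform_sub_invmx_pair _ _ _ (link_weight n alpha i)) ?ordS_neq ?tridiag_ordS //.
- set x := v 0 i; set y := v 0 (ordS i); rewrite /link_weight; case: ifP => _.
    rewrite mulrC divfK; last by rewrite gt_eqF // subr_gt0.
    by rewrite -mulrA.
  (* The wrap-around pair, on which M_SS is the identity. *)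
  have := addr_ge0 (sqr_ge0 x) (sqr_ge0 y).
  rewrite expr0n /= !(mulr0, mul0r, subr0) divr1; set z := _ + _ => z_ge0.
  by rewrite ler_piMl // gerBl sqr_ge0.
- by rewrite mxE eqxx.
- by rewrite mxE eqxx.
- by rewrite -(tridiag_ordS _ alpha) // -[in LHS]tridiag_mx_sym mxE.
- by rewrite gt_eqF // subr_gt0.
Qed.

Lemma two_lists2 : two_lists 2 = [set [set ord0; ord_max]].
Proof.
apply/setP => S; rewrite inE; apply/imsetP/eqP => [[i _ ->]|->]; last first.
  exists ord0; rewrite // (_ : ordS _ = ord_max) //; exact: val_inj.
have [->|->] : i = ord0 \/ i = ord_max.
    by case: i => [[|[|m]] lt] //; [left|right]; apply: val_inj.
  by rewrite (_ : ordS _ = ord_max) //; apply: val_inj.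
by rewrite finset.setUC (_ : ordS _ = ord0) //; apply: val_inj.
Qed.

(** Here each index lies in a single two-list, hence the coefficient 1 + 1 where
    the general case has 2 + 1. *)
Lemma qform_expectation2 {R : realType} (alpha : R) v :
  0 <= alpha -> alpha < 1 ->
  (1 - alpha ^+ 2) *
    qform (expectation_mx (two_list_sampling (n := 2))
             (sub_invmx (tridiag_mx 2 alpha))) v
    = 2%:R * qform 1%:M v - qform (tridiag_mx 2 alpha) v.
Proof.
move=> alpha_ge0 alpha_lt1; have alpha2_lt1 : alpha ^+ 2 < 1 by nra.
have S10 : ordS (ord0 : 'I_2) = ord_max by apply: val_inj.
have S01 : ordS (ord_max : 'I_2) = ord0 by apply: val_inj.
rewrite expectation_two_list two_lists2 cards1 invr1 scale1r big_set1 qform_tridiag //.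
rewrite (qform_sub_invmx_pair _ _ _ alpha) ?mxE //; last by rewrite gt_eqF // subr_gt0.
rewrite !qform1 !big_ord_recl !big_ord0 /link_weight /=.
have -> : lift ord0 ord0 = ord_max :> 'I_2 by apply: val_inj.
rewrite S10 S01 /=.
by field; rewrite gt_eqF // subr_gt0.
Qed.

(** * The spectral bound *)

(** Conjugation by B = T^(1/2) sends I to T and T to T^2, which reduces the
    claim to the inequalities T^2 >= 2 T - I and T <= (1 + 2 alpha) I. *)
Lemma qform_expectation_sqrt_le {R : realType} (n : nat) (alpha : R) v
  (T := tridiag_mx n alpha)
  (P := expectation_mx (two_list_sampling (n := n)) (sub_invmx T)) :
  (1 < n)%N -> 0 <= alpha <= 1 / 2%:R ->
  n%:R * (1 - alpha ^+ 2) * qform P (v *m sqrt_mx T)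
    <= 2%:R * (1 + alpha) * qform 1%:M v.
Proof.
move=> n_gt1 /andP[alpha_ge0 alpha_le].
have alpha_lt1 : alpha < 1 by lra.
have v_ge0 := qform1_ge0 v.
have [->|[[symB _] sqB]] := sqrt_mx_spec T.
  rewrite mulmx0 {1}/qform !mul0mx mxE mulr0.
  by rewrite !mulr_ge0 // addr_ge0.
have qT : qform 1%:M (v *m sqrt_mx T) = qform T v.
  by rewrite qform_congr symB mulmx1 sqB.
have qTT : qform T (v *m sqrt_mx T) = qform (T *m T) v.
  by rewrite qform_congr symB -[in RHS]sqB -{2}sqB !mulmxA.
have TT_ge := qform_sqr_ge T v (tridiag_mx_sym _ _).
have T_le := qform_tridiag_le n alpha v n_gt1 alpha_ge0.
have [n_gt2|n_le2] := ltnP 2 n.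
  have := qform_expectation_le n alpha (v *m sqrt_mx T) n_gt2 alpha_ge0 alpha_lt1.
  rewrite -/T -/P qT qTT; rewrite -/T in T_le; nra.
have n2 : n = 2 by lia.
subst n.
have := qform_expectation2 alpha (v *m sqrt_mx T) alpha_ge0 alpha_lt1.
rewrite -/T -/P qT qTT -mulrA => ->; have := mulr_ge0 alpha_ge0 v_ge0; lra.
Qed.

Theorem proposition3 (R : realType) (n : nat) (alpha : R)
    (n_ge2 : (2 <= n)%N) (alpha_bounds : 0 <= alpha <= 1 / 2%:R)
    (M G : 'M[R]_n) (defM : M = tridiag_mx n alpha) (defG : G = tridiag_mx n alpha) :
  theta (two_list_sampling (n := n)) M G <= 2%:R / ((1 - alpha) * n%:R).
Proof.
rewrite defM defG /theta; set T := tridiag_mx n alpha; set P := expectation_mx _ _.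
have /andP[alpha_ge0 alpha_le] := alpha_bounds.
have n_gt0 : 0 < n%:R :> R by rewrite ltr0n; lia.
have alpha_lt1 : 0 < 1 - alpha by lra.
apply: lambda_max_le => [|v]; first by rewrite divr_ge0 // mulr_ge0 ?ltW.
have symB : (sqrt_mx T)^T = sqrt_mx T.
  by have [->|[[]]] := sqrt_mx_spec T; first exact: trmx0.
rewrite -[X in _ *m X]symB -qform_congr.
(* Multiplying both sides by 1 + alpha turns 1 - alpha into 1 - alpha^2. *)
rewrite mulrAC ler_pdivlMr ?mulr_gt0 // -(ler_pM2r (_ : 0 < 1 + alpha)); last by lra.
have := qform_expectation_sqrt_le n alpha v n_ge2 alpha_bounds; rewrite -/T -/P; lra.
Qed.
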